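(* If a size-$2$ psd factorization of a matrix $M\in\mathcal{M}_{3,2}^{p\times q}$ is $1$-infinitesimally rigid, then it is locally rigid.
   Context: $\mathcal{S}^2$ (resp. $\mathcal{S}^2_+$) is the set of real symmetric (resp. symmetric positive semidefinite, psd) $2\times2$ matrices; $\langle X,Y\rangle=\operatorname{trace}(XY)$. A size-$k$ psd factorization of a nonnegative $p\times q$ matrix $M$ is a tuple $A^{(1)},\dots,A^{(p)},B^{(1)},\dots,B^{(q)}$ of $k\times k$ psd matrices with $M_{ij}=\langle A^{(i)},B^{(j)}\rangle$; the psd rank of $M$ is the smallest such $k$. $\mathcal{M}_{3,2}^{p\times q}$ is the set of nonnegative $p\times q$ matrices of rank $3$ and psd rank $2$. A $1$-infinitesimal motion of a size-$2$ psd factorization is a tuple $(\dot A^{(1)},\dots,\dot A^{(p)},\dot B^{(1)},\dots,\dot B^{(q)})$ of matrices in $\mathcal{S}^2$ such that (1) $\langle\dot A^{(i)},B^{(j)}\rangle+\langle A^{(i)},\dot B^{(j)}\rangle=0$ for all $i,j$; and (2) there is $\varepsilon>0$ such that for all $t\in[0,\varepsilon)$ and all nonempty $I\subseteq\{1,2\}$, $T^1([A^{(i)}+t\dot A^{(i)}]_I)\ge0$ for all $i$ and $T^1([B^{(j)}+t\dot B^{(j)}]_I)\ge0$ for all $j$. Here $[X]_I$ is the principal minor of $X$ with index set $I$, and $T^1(f)$ is the Taylor polynomial of order $1$ at $t=0$ of the polynomial $f(t)$. Put $\operatorname{vec}(X)=(X_{11},X_{22},\sqrt2X_{12})$ (row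 vector). If $M\in\mathcal{M}_{3,2}^{p\times q}$, every $1$-infinitesimal motion is given by a unique $D\in\mathbb{R}^{3\times3}$ via $\operatorname{vec}(\dot A^{(i)})=\operatorname{vec}(A^{(i)})D$ and $\operatorname{vec}(\dot B^{(j)})^T=-D\operatorname{vec}(B^{(j)})^T$. The motion is $1$-trivial if the same $D$ gives, by these formulas, a $1$-infinitesimal motion of every size-$2$ psd factorization of every matrix in $\mathcal{M}_{3,2}^{p\times q}$. A size-$2$ psd factorization is $1$-infinitesimally rigid if all its $1$-infinitesimal motions are $1$-trivial. $\mathrm{GL}(2)$ acts on size-$2$ psd factorizations of $M$ by $(A^{(i)},B^{(j)})\mapsto(S^TA^{(i)}S,S^{-1}B^{(j)}S^{-T})$. A size-$2$ psd factorization of $M$ is locally rigid if it has a neighborhood, in the space of all size-$2$ psd factorizations of $M$ (Euclidean topology), in which every psd factorization of $M$ lies in its $\mathrm{GL}(2)$-orbit. *)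

(* Defs.v *)
From HB Require Import structures.
From mathcomp Require Import all_boot all_order all_algebra.
From mathcomp Require Import all_classical all_reals all_analysis.
Set Implicit Arguments.
Unset Strict Implicit.
Unset Printing Implicit Defensive.
Import Order.TTheory GRing.Theory Num.Theory numFieldNormedType.Exports.
Local Open Scope ring_scope.

Section PsdFactorizations.
Context {R : realType}.

Definition psd (k : nat) (X : 'M[R]_k) : Prop :=
  X^T = X /\ forall x : 'cV[R]_k, 0 <= (x^T *m X *m x) 0 0.

Definition inner (k : nat) (X Y : 'M[R]_k) : R := \tr (X *m Y).

Definition psd_factorization (p q k : nat) (M : 'M[R]_(p, q))
    (A : 'I_p -> 'M[R]_k) (B : 'I_q -> 'M[R]_k) : Prop :=
  [/\ forall i, psd (A i), forall j, psd (B j)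
    & forall i j, M i j = inner (A i) (B j)].

Definition has_psd_rank (p q : nat) (M : 'M[R]_(p, q)) (k : nat) : Prop :=
  (exists A B, psd_factorization (k := k) M A B) /\
  (forall l, (exists A B, psd_factorization (k := l) M A B) -> (k <= l)%N).

Definition rank3_psdrank2 (p q : nat) (M : 'M[R]_(p, q)) : Prop :=
  [/\ forall i j, 0 <= M i j, \rank M = 3%N & has_psd_rank M 2].

Definition principal_minor (S : comNzRingType) (n : nat) (X : 'M[S]_n)
    (I : {set 'I_n}) : S :=
  \det (mxsub (fun a : 'I_#|I| => enum_val a) (fun a : 'I_#|I| => enum_val a) X).

(* Taylor polynomial of order s at 0. *)
Definition taylor (s : nat) (f : {poly R}) : {poly R} :=
  \sum_(i < s.+1) (f^`(i).[0] / i`!%:R) *: 'X^i.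

(* The path X + t dX, as a matrix of polynomials in t. *)
Definition line (n : nat) (X dX : 'M[R]_n) : 'M[{poly R}]_n :=
  map_mx polyC X + 'X *: map_mx polyC dX.

Definition infinitesimal_motion1 (p q : nat)
    (A : 'I_p -> 'M[R]_2) (B : 'I_q -> 'M[R]_2)
    (dA : 'I_p -> 'M[R]_2) (dB : 'I_q -> 'M[R]_2) : Prop :=
  [/\ (forall i, (dA i)^T = dA i) /\ (forall j, (dB j)^T = dB j),
      forall i j, inner (dA i) (B j) + inner (A i) (dB j) = 0
    & exists2 eps : R, 0 < eps &
        forall (t : R) (I : {set 'I_2}), 0 <= t < eps -> I != finset.set0 ->
          (forall i, 0 <= (taylor 1 (principal_minor (line (A i) (dA i)) I)).[t])
          /\
          (forall j, 0 <= (taylor 1 (principal_minor (line (B j) (dB j)) I)).[t])].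

(* On symmetric matrices, vec is a linear isometry onto R^3. *)
Definition vec (X : 'M[R]_2) : 'rV[R]_3 :=
  \row_j [:: X 0 0; X 1 1; Num.sqrt 2 * X 0 1]`_j.

(* D determines dA and dB uniquely from A and B, as vec is a bijection from
   the symmetric matrices to the row vectors. *)
Definition given_by (p q : nat) (D : 'M[R]_3)
    (A : 'I_p -> 'M[R]_2) (B : 'I_q -> 'M[R]_2)
    (dA : 'I_p -> 'M[R]_2) (dB : 'I_q -> 'M[R]_2) : Prop :=
  (forall i, (dA i)^T = dA i /\ vec (dA i) = vec (A i) *m D) /\
  (forall j, (dB j)^T = dB j /\ (vec (dB j))^T = - (D *m (vec (B j))^T)).

(* When (A, B) factorizes a matrix of rank 3, the D giving a motion of (A, B)
   is unique, so the existential below selects that D. *)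
Definition trivial_motion1 (p q : nat)
    (A : 'I_p -> 'M[R]_2) (B : 'I_q -> 'M[R]_2)
    (dA : 'I_p -> 'M[R]_2) (dB : 'I_q -> 'M[R]_2) : Prop :=
  exists2 D : 'M[R]_3, given_by D A B dA dB &
    forall (M : 'M[R]_(p, q)) A' B' dA' dB',
      rank3_psdrank2 M -> psd_factorization M A' B' ->
      given_by D A' B' dA' dB' -> infinitesimal_motion1 A' B' dA' dB'.

Definition infinitesimally_rigid1 (p q : nat)
    (A : 'I_p -> 'M[R]_2) (B : 'I_q -> 'M[R]_2) : Prop :=
  forall dA dB, infinitesimal_motion1 A B dA dB -> trivial_motion1 A B dA dB.

Definition same_GL2_orbit (p q : nat)
    (A : 'I_p -> 'M[R]_2) (B : 'I_q -> 'M[R]_2)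
    (A' : 'I_p -> 'M[R]_2) (B' : 'I_q -> 'M[R]_2) : Prop :=
  exists2 S : 'M[R]_2, S \in unitmx &
    (forall i, A' i = S^T *m A i *m S) /\
    (forall j, B' j = invmx S *m B j *m (invmx S)^T).

(* Tuples of matrices carry the product topology (on finitely many real
   coordinates, the Euclidean one); "within" gives the neighborhoods in the
   subspace of factorizations of M. *)
Definition locally_rigid (p q : nat) (M : 'M[R]_(p, q))
    (A : 'I_p -> 'M[R]_2) (B : 'I_q -> 'M[R]_2) : Prop :=
  \forall F \near within
      [set F : {ptws 'I_p -> 'M[R]_2} * {ptws 'I_q -> 'M[R]_2} |
        psd_factorization M F.1 F.2]%classic
      (nbhs ((A, B) : {ptws 'I_p -> 'M[R]_2} * {ptws 'I_q -> 'M[R]_2})),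
    same_GL2_orbit A B F.1 F.2.

End PsdFactorizations.

(* Main.v *)
Require Import Defs.
From mathcomp Require Import all_boot all_order all_algebra.
From mathcomp Require Import all_classical all_reals all_analysis.
From mathcomp Require Import ring lra.
Set Implicit Arguments.
Unset Strict Implicit.
Unset Printing Implicit Defensive.
Import Order.TTheory GRing.Theory Num.Theory numFieldNormedType.Exports.
Local Open Scope ring_scope.

(** Why the theorem holds.

    In the coordinates vec, the cone of psd 2 x 2 matrices is the self-dual
    solid light cone of the Lorentz form q(x) = 2 x0 x1 - x2^2 = x J x^T, and
    q(vec X) = 2 det X ([psd_lorentz]).  Stack the coordinates of the A(i) and
    B(j) as the rows of two matrices of rank 3.  Another factorization of the
    same M is obtained from (A, B) by one invertible matrix G, acting by G on
    the A side and by its inverse on the B side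
    ([factorization_transition]); it is close to (A, B) only if G is close to
    the identity.  The cone conditions on the new factorization see G only
    through N = G J G^T: on the A side they read a N a^T >= 0, on the B side
    b N^-1 b^T >= 0, with a = vec A(i) and b = vec B(j), and near the identity
    only the rank one factors, those with q = 0, impose anything.  The orbit
    is also read off from N: if N is a positive multiple of J, then G is a
    similarity of q preserving the cone, hence comes from some S in GL(2)
    ([gram_congr_mx]).  So local rigidity says that N = c J for all G near 1.

    Scale N to N / c = J + E with E symmetric and E_01 = 0; such E form a
    five-dimensional slice, transversal to the multiples of J.  To first order
    in E the constraints are linear inequalities, and they say exactly that
    D = E J / 2 is a 1-infinitesimal motion of (A, B).  If (A, B) is rigid,
    this D is trivial, so it is also a motion of factorizations in which some
    A(i), or some B(j), is an arbitrary rank one psd matrix.  The A side gives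
    a E a^T >= 0 on the whole light cone, and the B side, since the inverse
    reverses the sign of the perturbation, gives a E a^T <= 0.  A form that
    vanishes on the light cone is a multiple of J, so E = 0
    ([rigid_slice_eq0]).

    Hence the linearized system has only the zero solution.  By compactness of
    the unit sphere every E violates it by an amount proportional to |E|,
    which the quadratic remainder of the true constraints cannot make up for
    when E is small ([isolated_zero]).  So E = 0 and N = c J near (A, B). *)

(** * Small index types *)

Lemma sum2 (V : nmodType) (F : 'I_2 -> V) : \sum_i F i = F 0 + F 1.
Proof.
rewrite !big_ord_recl big_ord0 addr0; congr (_ + F _); exact: val_inj.
Qed.

Lemma sum3 (V : nmodType) (F : 'I_3 -> V) :
  \sum_i F i = F 0 + F 1 + F ord_max.
Proof.
rewrite !big_ord_recl big_ord0 addr0 addrA.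
congr (_ + F _ + F _); exact: val_inj.
Qed.

Lemma sum5 (V : nmodType) (F : 'I_5 -> V) : \sum_i F i =
  F 0 + F 1 + F (@Ordinal 5 2 isT) + F (@Ordinal 5 3 isT) + F ord_max.
Proof.
rewrite !big_ord_recl big_ord0 addr0 !addrA.
by congr (_ + F _ + F _ + F _ + F _); exact: val_inj.
Qed.

Lemma all_I2 (P : 'I_2 -> Prop) : P 0 -> P 1 -> forall i, P i.
Proof.
move=> P0 P1 [[|[|//]] hi].
- by move: P0; congr P; exact: val_inj.
- by move: P1; congr P; exact: val_inj.
Qed.

Lemma all_I3 (P : 'I_3 -> Prop) : P 0 -> P 1 -> P ord_max -> forall i, P i.
Proof.
move=> P0 P1 P2 [[|[|[|//]]] hi].
- by move: P0; congr P; exact: val_inj.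
- by move: P1; congr P; exact: val_inj.
- by move: P2; congr P; exact: val_inj.
Qed.

Lemma det2 (S : comNzRingType) (X : 'M[S]_2) :
  \det X = X 0 0 * X 1 1 - X 0 1 * X 1 0.
Proof.
rewrite (expand_det_row _ 0) sum2 /cofactor !det_mx11 !mxE /=.
have -> : lift (0 : 'I_2) (0 : 'I_1) = 1 by exact: val_inj.
have -> : lift (1 : 'I_2) (0 : 'I_1) = 0 by exact: val_inj.
by rewrite expr0 mul1r expr1 mulN1r mulrN.
Qed.

(** * The psd cone as a light cone *)
Section Coordinates.
Context {R : realType}.
Implicit Types (X Y : 'M[R]_2) (x y : 'rV[R]_3).

Definition row3 (a b c : R) : 'rV[R]_3 := \row_j [:: a; b; c]`_j.

Lemma row3E a b c :
  (row3 a b c 0 0 = a) * (row3 a b c 0 1 = b) * (row3 a b c 0 ord_max = c).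
Proof. by rewrite !mxE. Qed.

Lemma row3P x : x = row3 (x 0 0) (x 0 1) (x 0 ord_max).
Proof. by apply/rowP; apply: all_I3; rewrite row3E. Qed.

Lemma vecE X : vec X = row3 (X 0 0) (X 1 1) (Num.sqrt 2 * X 0 1).
Proof. by []. Qed.

Definition sym2 (a b c : R) : 'M[R]_2 :=
  \matrix_(i, j) if i == j then (if i == 0 then a else b) else c.

Lemma sym2E a b c : (sym2 a b c 0 0 = a) * (sym2 a b c 1 1 = b)
  * (sym2 a b c 0 1 = c) * (sym2 a b c 1 0 = c).
Proof. by rewrite !mxE. Qed.

Lemma sqrt2K : Num.sqrt 2 ^+ 2 = 2 :> R.
Proof. by rewrite sqr_sqrtr. Qed.

Lemma sqrt2_neq0 : Num.sqrt 2 != 0 :> R.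
Proof. by rewrite sqrtr_eq0 -ltNge. Qed.

Definition unvec x : 'M[R]_2 := sym2 (x 0 0) (x 0 1) (x 0 ord_max / Num.sqrt 2).

Lemma unvec_sym x : (unvec x)^T = unvec x.
Proof.
by apply/matrixP; apply: all_I2; apply: all_I2; rewrite mxE ?sym2E.
Qed.

Lemma unvecK x : vec (unvec x) = x.
Proof.
rewrite [RHS]row3P vecE !sym2E mulrC mulfVK//; exact: sqrt2_neq0.
Qed.

Lemma symE X : X^T = X -> X 1 0 = X 0 1.
Proof. by move=> XT; rewrite -{1}XT mxE. Qed.

Lemma vecK X : X^T = X -> unvec (vec X) = X.
Proof.
move=> XT; apply/matrixP; apply: all_I2; apply: all_I2;
  rewrite ?sym2E ?vecE ?row3E ?(symE XT)// mulrC mulKf//; exact: sqrt2_neq0.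
Qed.

Lemma vec_inj X Y : X^T = X -> Y^T = Y -> vec X = vec Y -> X = Y.
Proof. by move=> /vecK {2}<- /vecK {2}<- ->. Qed.

Lemma inner_vec X Y : X^T = X -> Y^T = Y ->
  inner X Y = (vec X *m (vec Y)^T) 0 0.
Proof.
move=> /symE X10 /symE Y10; rewrite /inner /mxtrace sum2 !mxE !sum2 sum3 !mxE /=.
have := sqrt2K; set s := Num.sqrt 2 => s2; rewrite X10 Y10.
transitivity (X 0 0 * Y 0 0 + X 1 1 * Y 1 1 + s ^+ 2 * X 0 1 * Y 0 1).
  by rewrite s2; ring.
by ring.
Qed.

(** The bilinear form x J y^T, with [J] below: through vec, the polarization of
    twice the determinant of symmetric 2 x 2 matrices. *)
Definition lorentz x y : R := x 0 0 * y 0 1 + x 0 1 * y 0 0 - x 0 ord_max * y 0 ord_max.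

Lemma lorentzNr x y : lorentz x (- y) = - lorentz x y.
Proof. by rewrite /lorentz !mxE; ring. Qed.

Lemma lorentz0l y : lorentz 0 y = 0.
Proof. by rewrite /lorentz !mxE; ring. Qed.

Lemma lorentz_vecE X Y : lorentz (vec X) (vec Y) =
  X 0 0 * Y 1 1 + X 1 1 * Y 0 0 - 2 * X 0 1 * Y 0 1.
Proof.
rewrite /lorentz !vecE !row3E.
have := sqrt2K; set s := Num.sqrt 2 => s2.
transitivity (X 0 0 * Y 1 1 + X 1 1 * Y 0 0 - s ^+ 2 * X 0 1 * Y 0 1).
  by ring.
by rewrite s2.
Qed.

Lemma lorentz_vec X : X^T = X -> lorentz (vec X) (vec X) = 2 * \det X.
Proof. by move=> /symE X10; rewrite det2 lorentz_vecE X10; ring. Qed.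

Lemma psdP X : psd X <->
  [/\ X^T = X, 0 <= X 0 0, 0 <= X 1 1 & X 0 1 ^+ 2 <= X 0 0 * X 1 1].
Proof.
have qE (x : 'cV[R]_2) : X^T = X -> (x^T *m X *m x) 0 0 =
    X 0 0 * x 0 0 ^+ 2 + 2 * X 0 1 * x 0 0 * x 1 0 + X 1 1 * x 1 0 ^+ 2.
  by move=> /symE X10; rewrite !mxE sum2 !mxE !sum2 !mxE X10; ring.
pose v (a b : R) : 'cV[R]_2 := \col_i if i == 0 then a else b.
split=> [[XT Xge]|[XT X0 X1 XX]].
  have H a b : 0 <= X 0 0 * a ^+ 2 + 2 * X 0 1 * a * b + X 1 1 * b ^+ 2.
    by have := Xge (v a b); rewrite qE// !mxE.
  have X0 : 0 <= X 0 0 by have := H 1 0; nra.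
  have X1 : 0 <= X 1 1 by have := H 0 1; nra.
  split=> //.
  have [X00|X00] := eqVneq (X 0 0) 0.
    have := H (- (X 1 1 + 1)) (X 0 1); have := H (- (X 1 1 + 1)) (X 0 1).
    by rewrite X00; nra.
  have := H (- X 0 1) (X 0 0).
  have -> : X 0 0 * (- X 0 1) ^+ 2 + 2 * X 0 1 * - X 0 1 * X 0 0
      + X 1 1 * X 0 0 ^+ 2 = X 0 0 * (X 0 0 * X 1 1 - X 0 1 ^+ 2) by ring.
  by rewrite pmulr_rge0 ?subr_ge0// lt_def X00.
split=> // x; rewrite qE//; set a := x 0 0; set b := x 1 0.
have [X00|X00] := eqVneq (X 0 0) 0.
  have X01 : X 0 1 = 0.
    by apply/eqP; rewrite -sqrf_eq0 eq_le sqr_ge0 andbT; rewrite X00 mul0r in XX.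
  by rewrite X00 X01; nra.
have Xpos : 0 < X 0 0 by rewrite lt_def X00.
rewrite -(pmulr_rge0 _ Xpos).
have -> : X 0 0 * (X 0 0 * a ^+ 2 + 2 * X 0 1 * a * b + X 1 1 * b ^+ 2) =
  (X 0 0 * a + X 0 1 * b) ^+ 2 + (X 0 0 * X 1 1 - X 0 1 ^+ 2) * b ^+ 2 by ring.
by rewrite addr_ge0 ?sqr_ge0// mulr_ge0 ?sqr_ge0// subr_ge0.
Qed.

Lemma psd_lorentz X : psd X <->
  [/\ X^T = X, 0 <= vec X 0 0, 0 <= vec X 0 1 & 0 <= lorentz (vec X) (vec X)].
Proof.
split.
  move/psdP=> [XT X0 X1 XX]; rewrite lorentz_vec// vecE !row3E; split=> //.
  by rewrite det2 (symE XT); nra.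
rewrite vecE !row3E => -[XT X0 X1]; rewrite -vecE lorentz_vec// det2 (symE XT).
by move=> H; apply/psdP; split=> //; nra.
Qed.

(** Self-duality of the cone.  In coordinates the worst case is
    x2 y2 = - |x2 y2|, and |x2 y2| <= 2 sqrt (x0 x1 y0 y1) <= x0 y0 + x1 y1 by
    the cone conditions and the inequality of arithmetic and geometric means. *)
Lemma psd_inner_ge0 X Y : psd X -> psd Y -> 0 <= inner X Y.
Proof.
move=> /psd_lorentz[XT X0 X1 XX] /psd_lorentz[YT Y0 Y1 YY].
rewrite inner_vec// mxE sum3 ![(_^T) _ _]mxE.
move: XX YY X0 X1 Y0 Y1; rewrite /lorentz.
set a := vec X 0 0; set b := vec X 0 1; set c := vec X 0 ord_max.
set a' := vec Y 0 0; set b' := vec Y 0 1; set c' := vec Y 0 ord_max.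
move=> H1 H2 a0 b0 a'0 b'0.
have cc : `|c * c'| <= a * a' + b * b'.
  have p0 : 0 <= a * a' + b * b' by rewrite addr_ge0 ?mulr_ge0.
  rewrite -(ler_pXn2r (n := 2))// ?nnegrE// real_normK ?num_real//.
  have : c ^+ 2 * c' ^+ 2 <= (2 * a * b) * (2 * a' * b').
    by apply: ler_pM; rewrite ?sqr_ge0//; nra.
  have := sqr_ge0 (a * a' - b * b'); nra.
have := ler_norm (- (c * c')); rewrite normrN; lra.
Qed.

End Coordinates.

(** * Linear inequalities with a quadratic error *)
Section Isolation.
Context {R : realType}.
Lemma entry_le_norm n (x : 'rV[R]_n) j : `|x 0 j| <= `|x|.
Proof.
rewrite [leRHS]/Num.Def.normr /= mx_normrE.
by apply/bigmax_geP; right => /=; exists (0, j).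
Qed.

Lemma cvg_sumr (T : Type) (F : set_system T) (I : Type) (r : seq I)
    (P : pred I) (f : I -> T -> R) (a : I -> R) : Filter F ->
  (forall i, P i -> f i x @[x --> F] --> a i)%classic ->
  (\sum_(i <- r | P i) f i x @[x --> F] --> \sum_(i <- r | P i) a i)%classic.
Proof. by move=> FF; apply: cvg_big => //; exact: add_continuous. Qed.

(** The sum f of the negative parts of the l_k is positively homogeneous,
    continuous, and positive off 0, so f(x) >= m |x| with m > 0 its minimum on
    the unit sphere.  A solution x of the perturbed system has
    f(x) <= K |x|^2, whence x = 0 or |x| >= m / K.  The radius is stated on
    the coordinates of x, which is how it is compared with limits later. *)
Lemma isolated_zero (n : nat) (T : finType) (P : pred T)
    (l : T -> 'cV[R]_n.+1) (r : T -> 'rV[R]_n.+1 -> R) (C : T -> R) :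
  (forall x : 'rV[R]_n.+1, (forall k, P k -> 0 <= (x *m l k) 0 0) -> x = 0) ->
  (forall k x, `|r k x| <= C k * `|x| ^+ 2) ->
  exists2 e, 0 < e & forall x : 'rV[R]_n.+1, (forall j, `|x 0 j| < e) ->
    (forall k, P k -> 0 <= (x *m l k) 0 0 + r k x) -> x = 0.
Proof.
move=> l0 rC.
pose f (x : 'rV[R]_n.+1) := \sum_(k | P k) Num.max 0 (- (x *m l k) 0 0).
have fZ a x : 0 <= a -> f (a *: x) = a * f x.
  move=> a0; rewrite /f mulr_sumr; apply: eq_bigr => k _.
  by rewrite -scalemxAl mxE -mulrN maxr_pMr// mulr0.
have lcont k : continuous (fun x : 'rV[R]_n.+1 => (x *m l k) 0 0).
  move=> x; under eq_fun do rewrite mxE.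
  rewrite /continuous_at; apply: (@cvg_sumr _ (nbhs x)) => /= j _.
  by apply: cvgMl; exact: coord_continuous.
have fcont : continuous f.
  move=> x; apply: (@cvg_sumr _ (nbhs x)) => /= k _.
  have c0 : {for x, continuous (fun _ : 'rV[R]_n.+1 => 0 : R^o)} by exact: cst_continuous.
  have c1 : {for x, continuous (fun x : 'rV[R]_n.+1 => - (x *m l k) 0 0 : R^o)}.
    exact: (@continuousN R R^o _ _ x (lcont k x)).
  exact: (continuous_max c0 c1).
pose S := [set x : 'rV[R]_n.+1 | `|x| = 1]%classic.
have S0 : (S !=set0)%classic.
  exists (`|const_mx 1 : 'rV[R]_n.+1|^-1 *: const_mx 1); rewrite /S /=.
  have one0 : `|const_mx 1 : 'rV[R]_n.+1| != 0.
    rewrite normr_eq0; apply/eqP => /rowP/(_ 0); rewrite !mxE => /eqP.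
    by rewrite oner_eq0.
  by rewrite normrZ ger0_norm ?invr_ge0// mulVf.
have Sc : compact S.
  apply: bounded_closed_compact.
    exists 1; split; first exact: num_real.
    by move=> M M1 x /= ->; exact: ltW.
  apply: (@closed_comp _ _ (fun x : 'rV[R]_n.+1 => `|x|) [set 1]%classic) => // x _.
  exact: norm_continuous.

have [c /set_mem cS cmin] := EVT_min_rV S0 Sc (continuous_subspaceT fcont).
have fge0 x : 0 <= f x by apply: sumr_ge0 => k _; rewrite le_max lexx.
have fc0 : 0 < f c.
  rewrite lt_def fge0 andbT; apply/negP => fc.
  have c0 : c = 0.
    apply: l0 => k Pk; move: fc; rewrite psumr_eq0; last first.
      by move=> i _; rewrite le_max lexx.
    move/allP/(_ k); rewrite mem_index_enum Pk => /(_ isT)/eqP m0.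
    by rewrite -oppr_le0 -m0 le_max lexx orbT.
  by move: cS; rewrite /S /= c0 normr0 => /esym/eqP; rewrite oner_eq0.
have flow x : f c * `|x| <= f x.
  have [->|x0] := eqVneq x 0; first by rewrite normr0 mulr0.
  have nx0 : `|x| != 0 by rewrite normr_eq0.
  have -> : f x = `|x| * f (`|x|^-1 *: x) by rewrite -fZ// scalerA divff// scale1r.
  rewrite mulrC ler_wpM2l// cmin// inE /S /= normrZ ger0_norm ?invr_ge0//.
  by rewrite mulVf.
pose K := 1 + \sum_(k | P k) `|C k|.
have K0 : 0 < K by rewrite ltr_pwDl// sumr_ge0.
exists (f c / K); first exact: divr_gt0.
move=> x xs xP.
have [//|x0] := eqVneq x 0.
have nx : `|x| < f c / K.
  rewrite [ltLHS]/Num.Def.normr /= mx_normrE bigmax_lt ?divr_gt0//= => -[i j] _ /=.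
  by rewrite (ord1 i).
have nx0 : 0 < `|x| by rewrite normr_gt0.
have fup : f x <= K * `|x| ^+ 2.
  apply: (@le_trans _ _ (\sum_(k | P k) `|C k| * `|x| ^+ 2)).
    apply: ler_sum => k Pk; rewrite ge_max mulr_ge0 ?sqr_ge0//=.
    apply: le_trans (ler_wpM2r (sqr_ge0 _) (ler_norm _)).
    apply: le_trans (rC k x); apply: le_trans (ler_norm _).
    by have := xP k Pk; lra.
  by rewrite -mulr_suml ler_wpM2r ?sqr_ge0// lerDr.
have := le_trans (flow x) fup; rewrite expr2 mulrA ler_pM2r// => h.
have KV : 0 <= K^-1 by rewrite invr_ge0 ltW.
by have := lt_le_trans nx (ler_wpM2r KV h); rewrite mulrAC mulfV ?gt_eqF// mul1r ltxx.
Qed.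
End Isolation.

(** * Infinitesimal motions as first-order cone conditions *)
Section FirstOrder.
Context {R : realType}.
Implicit Types (X Y : 'M[R]_2) (x y : 'rV[R]_3).

Lemma principal_minor1 (S : comNzRingType) (X : 'M[S]_2) (I : {set 'I_2}) :
  #|I| = 1%N -> exists i, principal_minor X I = X i i.
Proof.
rewrite /principal_minor; move: (fun a : 'I_#|I| => _) => f.
move: #|I| f => k f k1; subst k.
by exists (f 0); rewrite det_mx11 mxE.
Qed.

(** The enumeration of a two-element subset of 'I_2 permutes the rows and the
    columns in the same way, which leaves the determinant unchanged. *)
Lemma principal_minor_full (S : comNzRingType) (X : 'M[S]_2) (I : {set 'I_2}) :
  #|I| = 2%N -> principal_minor X I = \det X.
Proof.
rewrite /principal_minor.
have : injective (fun a : 'I_#|I| => enum_val a) by exact: enum_val_inj.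
move: (fun a : 'I_#|I| => _) => f.
move: #|I| f => k f + k2; subst k => finj.
have : f 0 != f 1 by rewrite (inj_eq finj).
rewrite !det2 !mxE; move: (f 0) (f 1).
by apply: all_I2; apply: all_I2 => //= _; ring.
Qed.

Lemma principal_minor_cases (S : comNzRingType) (X : 'M[S]_2) (I : {set 'I_2}) :
  I != finset.set0 ->
  (exists i, principal_minor X I = X i i) \/ principal_minor X I = \det X.
Proof.
rewrite -card_gt0 => I0; have := max_card (mem I); rewrite card_ord => I2.
move: I0 I2; rewrite leq_eqVlt => /orP[/eqP/esym/(principal_minor1 X)|I1 I2].
  by left.
by right; apply: principal_minor_full; apply/eqP; rewrite eqn_leq I2.
Qed.

Lemma taylor1E (f : {poly R}) t : (taylor 1 f).[t] = f.[0] + (deriv f).[0] * t.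
Proof.
rewrite /taylor !big_ord_recl big_ord0 addr0 hornerD !hornerZ !hornerXn.
by rewrite /= /bump /= expr0 expr1 !divr1 mulr1.
Qed.

Lemma lineE X dX i j : line X dX i j = (X i j)%:P + 'X * (dX i j)%:P.
Proof. by rewrite !mxE. Qed.

Lemma taylor1_diag X dX i t :
  (taylor 1 (line X dX i i)).[t] = X i i + t * dX i i.
Proof.
by rewrite taylor1E lineE !poly.derivE !hornerE /=; ring.
Qed.

Lemma taylor1_det X dX t : X^T = X -> dX^T = dX ->
  (taylor 1 (\det (line X dX))).[t] = \det X + t * lorentz (vec X) (vec dX).
Proof.
move=> /symE X10 /symE dX10; rewrite taylor1E !det2 !lineE !poly.derivE !hornerE /=.
by rewrite lorentz_vecE X10 dX10; ring.
Qed.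

(** For X on the light cone, dX points to the side where q is nonnegative.
    This is the only condition that the 1-truncated principal minors impose on
    the derivative of a psd matrix, apart from that at X = 0. *)
Definition inward X dX :=
  lorentz (vec X) (vec X) = 0 -> 0 <= lorentz (vec X) (vec dX).

Lemma line_ge0 (a b : R) : 0 <= a -> (a = 0 -> 0 <= b) ->
  exists2 e, 0 < e & forall t, 0 <= t < e -> 0 <= a + t * b.
Proof.
move=> a0 ab; have [a00|aN0] := eqVneq a 0.
  by exists 1 => // t /andP[t0 _]; rewrite a00 add0r mulr_ge0// ab.
have apos : 0 < a by rewrite lt_def aN0.
have b1 : 0 < `|b| + 1 by rewrite ltr_wpDl.
exists (a / (`|b| + 1)); first by rewrite divr_gt0.
move=> t /andP[t0]; rewrite ltr_pdivlMr// => te.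
have := ler_norm (- b); rewrite normrN => bn.
have : t * (- b) <= t * `|b| by rewrite ler_wpM2l.
by nra.
Qed.

(** Minors positive at t = 0 stay so for small t.  If a diagonal entry of X
    vanishes, then so does X 0 1, X is on the light cone, and the inward
    condition becomes the nonnegativity of dX i i times the other diagonal
    entry.  The last hypothesis covers X = 0, where inward is void but the
    diagonal of dX is constrained; motions given by a matrix D satisfy it. *)
Lemma inward_minors X dX : psd X -> dX^T = dX -> inward X dX ->
    (X = 0 -> dX = 0) ->
  exists2 e, 0 < e & forall t, 0 <= t < e -> forall I : {set 'I_2}, I != finset.set0 ->
    0 <= (taylor 1 (principal_minor (line X dX) I)).[t].
Proof.
move=> Xpsd dXT Xin X0; have [XT X00 X11 XX] := (psdP X).1 Xpsd.
have L := lorentz_vecE X dX.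
have diag i : X i i = 0 -> 0 <= dX i i.
  move=> Xii.
  have X01 : X 0 1 = 0.
    apply/eqP; rewrite -sqrf_eq0 eq_le sqr_ge0 andbT (le_trans XX)//.
    by move: i Xii; apply: all_I2 => ->; rewrite ?mul0r ?mulr0 lexx.
  have q0 : lorentz (vec X) (vec X) = 0.
    rewrite lorentz_vec// det2 (symE XT) X01.
    by move: i Xii; apply: all_I2 => ->; rewrite ?(mul0r,mulr0,subr0).
  have := Xin q0; rewrite L X01 !(mulr0,mul0r) subr0.
  have [Z0|Z0] := eqVneq X 0; first by rewrite (X0 Z0) !mxE.
  move: i Xii Z0; apply: all_I2 => Xii Z0; rewrite Xii mul0r ?add0r ?addr0 pmulr_rge0//.
    rewrite lt_def X11 andbT; apply: contraNN Z0 => /eqP X11z.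
    by apply/eqP/matrixP; apply: all_I2; apply: all_I2;
       rewrite [RHS]mxE ?(symE XT).
  rewrite lt_def X00 andbT; apply: contraNN Z0 => /eqP X11z.
  by apply/eqP/matrixP; apply: all_I2; apply: all_I2;
       rewrite [RHS]mxE ?(symE XT).
have [e0 e0p H0] := line_ge0 X00 (diag 0).
have [e1 e1p H1] := line_ge0 X11 (diag 1).
have det0 : 0 <= \det X by rewrite det2 (symE XT); nra.
have [|e2 e2p H2] := line_ge0 (b := lorentz (vec X) (vec dX)) det0.
  by move=> d0; apply: Xin; rewrite lorentz_vec// d0 mulr0.
exists (Num.min e0 (Num.min e1 e2)); first by rewrite !lt_min e0p e1p e2p.
move=> t; rewrite !lt_min => /and4P[t0 te0 te1 te2] I I0.
have [[i ->]|->] := principal_minor_cases (line X dX) I0.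
  rewrite taylor1_diag; move: i; apply: all_I2; [apply: H0|apply: H1];
  by rewrite t0.
by rewrite taylor1_det//; apply: H2; rewrite t0.
Qed.

Lemma minors_inward X dX e : X^T = X -> dX^T = dX -> 0 < e ->
  (forall t (I : {set 'I_2}), 0 <= t < e -> I != finset.set0 ->
    0 <= (taylor 1 (principal_minor (line X dX) I)).[t]) -> inward X dX.
Proof.
move=> XT dXT e0 H q0.
have half : 0 <= e / 2 < e.
  by rewrite divr_ge0 ?(ltW e0)//= ltr_pdivrMr// mulr_natr mulr2n ltrDl.
have cT : #|[set: 'I_2]| = 2%N by rewrite cardsT card_ord.
have := H _ [set: 'I_2]%SET half.
rewrite -card_gt0 cT => /(_ isT).
rewrite principal_minor_full// taylor1_det//.
have -> : \det X = 0.
  by move: q0; rewrite lorentz_vec// => /eqP; rewrite mulf_eq0 pnatr_eq0/= => /eqP.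
by rewrite add0r pmulr_rge0// divr_gt0.
Qed.

Lemma common_eps (T : finType) (P : T -> R -> Prop) :
  (forall i, exists2 e, 0 < e & forall t, 0 <= t < e -> P i t) ->
  exists2 e, 0 < e & forall t, 0 <= t < e -> forall i, P i t.
Proof.
move=> H; have /choice[f fP] : forall i, exists e, 0 < e /\
    forall t, 0 <= t < e -> P i t.
  by move=> i; have [e e0 eP] := H i; exists e.
exists (\big[Num.min/1]_i f i).
  by apply/bigmin_gtP; split=> // i _; have [] := fP i.
move=> t /andP[t0 /bigmin_gtP[_ te]] i.
by have [_] := fP i; apply; rewrite t0 te.
Qed.

Lemma motion_inward (p q : nat) (A : 'I_p -> 'M[R]_2) (B : 'I_q -> 'M[R]_2) dA dB :
  (forall i, psd (A i)) -> (forall j, psd (B j)) ->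
  infinitesimal_motion1 A B dA dB ->
  (forall i, inward (A i) (dA i)) /\ (forall j, inward (B j) (dB j)).
Proof.
move=> Apsd Bpsd [[dAT dBT] _ [e e0 H]]; split=> i.
  apply: (minors_inward (Apsd i).1 (dAT i) e0) => t I te I0.
  exact: (H t I te I0).1.
apply: (minors_inward (Bpsd i).1 (dBT i) e0) => t I te I0.
exact: (H t I te I0).2.
Qed.

Lemma inward_motion (p q : nat) (A : 'I_p -> 'M[R]_2) (B : 'I_q -> 'M[R]_2) D dA dB :
  (forall i, psd (A i)) -> (forall j, psd (B j)) -> given_by D A B dA dB ->
  (forall i, inward (A i) (dA i)) -> (forall j, inward (B j) (dB j)) ->
  infinitesimal_motion1 A B dA dB.
Proof.
move=> Apsd Bpsd [gA gB] inA inB; split.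
- by split=> i; [have [] := gA i|have [] := gB i].
- move=> i j; have [dAT dAD] := gA i; have [dBT dBD] := gB j.
  rewrite !inner_vec ?(Apsd i).1 ?(Bpsd j).1// dAD dBD mulmxN mulmxA.
  by rewrite [X in _ + X]mxE subrr.
- have A0 i : A i = 0 -> dA i = 0.
    move=> Ai0; have [dAT dAD] := gA i; apply: vec_inj; rewrite ?trmx0//.
    rewrite dAD Ai0; have -> : vec (0 : 'M[R]_2) = 0.
      by rewrite [LHS]row3P [RHS]row3P !row3E !mxE !mulr0.
    by rewrite mul0mx.
  have B0 j : B j = 0 -> dB j = 0.
    move=> Bi0; have [dBT dBD] := gB j; apply: vec_inj; rewrite ?trmx0//.
    apply: trmx_inj; rewrite dBD Bi0; have -> : vec (0 : 'M[R]_2) = 0.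
      by rewrite [LHS]row3P [RHS]row3P !row3E !mxE !mulr0.
    by rewrite trmx0 mulmx0 oppr0.
  have [eA eA0 HA] := common_eps
    (fun i => @inward_minors _ _ (Apsd i) (gA i).1 (inA i) (@A0 i)).
  have [eB eB0 HB] := common_eps
    (fun j => @inward_minors _ _ (Bpsd j) (gB j).1 (inB j) (@B0 j)).
  exists (Num.min eA eB); first by rewrite lt_min eA0.
  move=> t I; rewrite lt_min => /and3P[t0 tA tB] I0.
  by split=> i; [apply: HA|apply: HB]; rewrite ?t0.
Qed.
End FirstOrder.

(** * The slice of perturbations of the form *)
Section Slice.
Context {R : realType}.
Implicit Types (X Y U : 'M[R]_2) (x y a b : 'rV[R]_3) (e : 'rV[R]_5) (D : 'M[R]_3).

Definition mx33 (s : seq (seq R)) : 'M[R]_3 := \matrix_(i, j) (nth [::] s i)`_j.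

Definition J : 'M[R]_3 := mx33 [:: [:: 0; 1; 0]; [:: 1; 0; 0]; [:: 0; 0; -1]].

Lemma lorentzE x y : lorentz x y = (x *m J *m y^T) 0 0.
Proof. by rewrite /lorentz !mxE sum3 !mxE !sum3 !mxE /=; ring. Qed.

Lemma J_tr : J^T = J.
Proof.
by apply/matrixP; apply: all_I3; apply: all_I3; rewrite !mxE.
Qed.

Lemma JJ : J *m J = 1%:M.
Proof.
apply/matrixP; apply: all_I3; apply: all_I3; rewrite !mxE sum3 !mxE /=; ring.
Qed.

Lemma det_J : \det J = 1 :> R.
Proof.
by rewrite (expand_det_row _ 0) sum3 /cofactor !det2 !mxE /=; ring.
Qed.

Lemma mulJE x : x *m J = row3 (x 0 1) (x 0 0) (- x 0 ord_max).
Proof.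
by apply/rowP; apply: all_I3; rewrite row3E mxE sum3 !mxE /=; ring.
Qed.

(** The symmetric matrices whose (0, 1) entry is 0.  As J has (0, 1) entry 1,
    every symmetric matrix is uniquely a multiple of J plus such a matrix. *)
Definition slice_mx e : 'M[R]_3 :=
  let e2 := e 0 (@Ordinal 5 2 isT) in
  let e3 := e 0 (@Ordinal 5 3 isT) in let e4 := e 0 ord_max in
  mx33 [:: [:: e 0 0; 0; e3]; [:: 0; e 0 1; e4]; [:: e3; e4; e2]].

(** The quadratic form of [slice_mx e] at a, seen as a linear form in e
    ([quad_coefE]). *)
Definition quad_coef a : 'cV[R]_5 :=
  \col_j [:: a 0 0 ^+ 2; a 0 1 ^+ 2; a 0 ord_max ^+ 2;
             2 * a 0 0 * a 0 ord_max; 2 * a 0 1 * a 0 ord_max]`_j.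

Lemma slice_mx_tr e : (slice_mx e)^T = slice_mx e.
Proof.
by apply/matrixP; apply: all_I3; apply: all_I3; rewrite !mxE.
Qed.

Lemma quad_coefE e a : (e *m quad_coef a) 0 0 = (a *m slice_mx e *m a^T) 0 0.
Proof.
by rewrite !mxE sum5 !sum3 !mxE !sum3 !mxE /=; ring.
Qed.

(** The matrix D for which 1 + t D moves J by t times [slice_mx e] to first
    order: D J + J D^T = [slice_mx e], because J is an involution. *)
Definition slice_motion e : 'M[R]_3 := 2^-1 *: (slice_mx e *m J).

Lemma lorentz_motionl e a :
  lorentz a (a *m slice_motion e) = 2^-1 * (e *m quad_coef a) 0 0.
Proof.
rewrite lorentzE quad_coefE trmx_mul [(slice_motion e)^T]linearZ /= trmx_mul.
rewrite J_tr slice_mx_tr -scalemxAl -scalemxAr [LHS]mxE; congr (_ * _).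
by rewrite !mulmxA -[a *m J *m J]mulmxA JJ mulmx1.
Qed.

Lemma lorentz_motionr e b :
  lorentz b (slice_motion e *m b^T)^T = 2^-1 * (e *m quad_coef (b *m J)) 0 0.
Proof.
rewrite lorentzE quad_coefE trmxK -scalemxAl -scalemxAr [LHS]mxE; congr (_ * _).
by rewrite trmx_mul J_tr !mulmxA.
Qed.

Definition outer2 (s t : R) : 'M[R]_2 := sym2 (s ^+ 2) (t ^+ 2) (s * t).

Lemma outer2_psd s t : psd (outer2 s t).
Proof.
apply/psdP; rewrite !sym2E !sqr_ge0; split=> //; last by rewrite exprMn.
by apply/matrixP; apply: all_I2; apply: all_I2; rewrite mxE ?sym2E.
Qed.

Lemma outer2_lightlike s t : lorentz (vec (outer2 s t)) (vec (outer2 s t)) = 0.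
Proof. by rewrite lorentz_vecE !sym2E; ring. Qed.

(** J permutes the extreme rays of the cone, so what holds at the B side for
    all rank one matrices can be transported to the A side. *)
Lemma outer2J s t : vec (outer2 s t) *m J = vec (outer2 t (- s)).
Proof. by rewrite mulJE !vecE !row3E !sym2E sqrrN mulrN mulrN [s * t]mulrC. Qed.

(** A quadratic form vanishing on the light cone is a multiple of the Lorentz
    form, and the slice contains no such multiple except 0.  Five points of
    the cone suffice: (s, t) = (1, 0), (0, 1), (1, 1), (1, -1), (2, 1). *)
Lemma quad_outer2_eq0 e :
  (forall s t, (e *m quad_coef (vec (outer2 s t))) 0 0 = 0) -> e = 0.
Proof.
set e2 := e 0 (@Ordinal 5 2 isT); set e3 := e 0 (@Ordinal 5 3 isT).
set e4 := e 0 ord_max.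
have r0 := @sqrt2_neq0 R; have r2 := @sqrt2K R.
set r := Num.sqrt 2 in r0 r2 *.
move=> H; have H' s t : e 0 0 * s ^+ 4 + e 0 1 * t ^+ 4 +
    e2 * (2 * (s * t) ^+ 2) + 2 * r * (e3 * (s ^+ 3 * t) + e4 * (s * t ^+ 3)) = 0.
  rewrite -[RHS](H s t) mxE sum5 !mxE /= -/r -/e2 -/e3 -/e4.
  by rewrite [(r * _) ^+ 2]exprMn r2; ring.
have E0 : e 0 0 = 0 by have := H' 1 0; lra.
have E1 : e 0 1 = 0 by have := H' 0 1; lra.
have h1 := H' 1 1; have h2 := H' 1 (-1); have h3 := H' 2 1.
rewrite E0 E1 in h1 h2 h3.
have E2 : e2 = 0 by lra.
have k1 : r * (e3 + e4) = 0 by rewrite E2 in h1; lra.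
have k2 : r * (8 * e3 + 2 * e4) = 0 by rewrite E2 in h3; lra.
move/eqP: k1; rewrite mulf_eq0 (negPf r0) /= => /eqP k1.
move/eqP: k2; rewrite mulf_eq0 (negPf r0) /= => /eqP k2.
have E3 : e3 = 0 by lra.
have E4 : e4 = 0 by lra.
apply/rowP => -[[|[|[|[|[|//]]]]] hi]; rewrite [RHS]mxE.
- by rewrite -[RHS]E0; congr (e _ _); exact: val_inj.
- by rewrite -[RHS]E1; congr (e _ _); exact: val_inj.
- by rewrite -[RHS]E2; congr (e _ _); exact: val_inj.
- by rewrite -[RHS]E3; congr (e _ _); exact: val_inj.
- by rewrite -[RHS]E4; congr (e _ _); exact: val_inj.
Qed.

Definition vecs (n : nat) (A : 'I_n -> 'M[R]_2) : 'M[R]_(n, 3) :=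
  \matrix_i vec (A i).

Lemma factorization_vecs p q (M : 'M[R]_(p, q)) A B :
  psd_factorization M A B -> M = vecs A *m (vecs B)^T.
Proof.
move=> [Apsd Bpsd MAB]; apply/matrixP => i j.
rewrite MAB inner_vec ?(Apsd i).1 ?(Bpsd j).1//.
by rewrite !mxE; apply: eq_bigr => k _; rewrite !mxE.
Qed.

Lemma rank3_vecs p q (M : 'M[R]_(p, q)) A B : \rank M = 3%N ->
  psd_factorization M A B -> row_full (vecs A) /\ row_full (vecs B).
Proof.
move=> r3 /factorization_vecs E; rewrite /row_full !eqn_leq !rank_leq_col /=.
have := mxrankM_maxl (vecs A) (vecs B)^T.
have := mxrankM_maxr (vecs A) (vecs B)^T.
by rewrite -E r3 mxrank_tr.
Qed.

(** For l <= 1 the inner product is the sum of the at most one products of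
    diagonal entries, which exhibits M as a product through dimension l. *)
Lemma small_factorization_rank p q l (M : 'M[R]_(p, q)) A B : (l <= 1)%N ->
  psd_factorization (k := l) M A B -> (\rank M <= l)%N.
Proof.
move=> l1 [_ _ MAB].
have -> : M = (\matrix_(i, k) A i k k) *m (\matrix_(k, j) B j k k).
  apply/matrixP => i j; rewrite MAB /inner /mxtrace mxE; apply: eq_bigr => k _.
  have ord_zero (k' : 'I_l) : val k' = 0%N.
    by apply/eqP; rewrite -leqn0 -ltnS; exact: leq_trans (ltn_ord k') l1.
  rewrite !mxE (bigD1 k)//= big1 ?addr0// => k' /negP[].
  by apply/eqP/val_inj; rewrite !ord_zero.
exact: mulmx_max_rank.
Qed.

(** Produces members of the class of matrices of rank 3 and psd rank 2: the
    rank alone excludes psd factorizations of size 0 and 1. *)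
Lemma full_rank3_psdrank2 p q (A : 'I_p -> 'M[R]_2) (B : 'I_q -> 'M[R]_2) :
  (forall i, psd (A i)) -> (forall j, psd (B j)) ->
  row_full (vecs A) -> row_full (vecs B) ->
  let M := \matrix_(i, j) inner (A i) (B j) in
  psd_factorization M A B /\ rank3_psdrank2 M.
Proof.
move=> Apsd Bpsd fA fB M.
have MAB : psd_factorization M A B by split=> // i j; rewrite mxE.
have rM : \rank M = 3%N.
  rewrite (factorization_vecs MAB) mxrankMfree; first exact/eqP.
  by rewrite /row_free mxrank_tr.
split=> //; split=> //; first by move=> i j; rewrite mxE psd_inner_ge0.
split; first by exists A, B.
move=> l [A' [B' MAB']]; rewrite leqNgt; apply/negP => l1.
have := small_factorization_rank l1 MAB'; rewrite rM => l3.
by move: (leq_trans l3 l1).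
Qed.

End Slice.

(** * Trivial motions fix the light cone *)

(** Steinitz exchange: x is a combination of the rows of V, and any row that
    occurs in it with a nonzero coefficient can be traded for x. *)
Lemma row_full_exchange (F : fieldType) m n (V : 'M[F]_(m, n)) (x : 'rV[F]_n) :
  row_full V -> x != 0 ->
  exists i, row_full (\matrix_k (if k == i then x else row k V)).
Proof.
move=> fV x0; pose c := x *m pinvmx V.
have cV : c *m V = x by rewrite mulmxKpV// submx_full.
have [c0|/rV0Pn[i ci]] := eqVneq c 0.
  by move: x0; rewrite -cV c0 mul0mx eqxx.
exists i; set V' := \matrix_k _.
have rV' k : k != i -> (row k V <= V')%MS.
  by move=> ki; rewrite (eq_row_sub k)// rowK (negPf ki).
rewrite -sub1mx (submx_trans (_ : _ <= V)%MS) ?sub1mx//.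
apply/row_subP => k; have [->|/rV'//] := eqVneq k i.
have -> : row i V = (c 0 i)^-1 *: (x - \sum_(j | j != i) c 0 j *: row j V).
  rewrite -cV mulmx_sum_row [X in X - _](bigD1 i)//= addrK scalerA mulVf//.
  by rewrite scale1r.
apply/scalemx_sub/addmx_sub; first by rewrite (eq_row_sub i)// rowK eqxx.
rewrite -scaleN1r scalemx_sub//; apply: summx_sub => j ji.
by apply: scalemx_sub; exact: rV'.
Qed.

Section TrivialMotions.
Context {R : realType}.
Implicit Types (X Y U : 'M[R]_2) (x y a b : 'rV[R]_3) (e : 'rV[R]_5) (D : 'M[R]_3).

Lemma psd_family_through n (A : 'I_n -> 'M[R]_2) U :
  (forall i, psd (A i)) -> row_full (vecs A) -> psd U -> vec U != 0 ->
  exists i, exists A' : 'I_n -> 'M[R]_2,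
    [/\ forall k, psd (A' k), row_full (vecs A') & A' i = U].
Proof.
move=> Apsd fA Upsd /(row_full_exchange fA)[i fi].
exists i, (fun k => if k == i then U else A k); split.
- by move=> k; case: ifP.
- congr (row_full _): fi; apply/row_matrixP => k; rewrite !rowK.
  by case: ifP => // _; rewrite rowK.
- by rewrite eqxx.
Qed.

(** The condition on D in the definition of a trivial motion. *)
Definition always_motion (p q : nat) D := forall (M : 'M[R]_(p, q)) A B dA dB,
  rank3_psdrank2 M -> psd_factorization M A B -> given_by D A B dA dB ->
  infinitesimal_motion1 A B dA dB.

Lemma given_by_exists p q D (A : 'I_p -> 'M[R]_2) (B : 'I_q -> 'M[R]_2) :
  given_by D A B (fun i => unvec (vec (A i) *m D))
                 (fun j => unvec (- (D *m (vec (B j))^T)^T)).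
Proof.
split=> i; rewrite unvec_sym unvecK; split=> //.
by rewrite [LHS]linearN /= trmxK.
Qed.

(** Any rank one psd matrix can be made a factor of a suitable factorization,
    on either side, by exchanging it for one of the given factors; there the
    motion given by D must point inward. *)
Lemma always_motion_lightlike p q (A : 'I_p -> 'M[R]_2) (B : 'I_q -> 'M[R]_2)
    D U :
  (forall i, psd (A i)) -> (forall j, psd (B j)) ->
  row_full (vecs A) -> row_full (vecs B) -> always_motion p q D ->
  psd U -> lorentz (vec U) (vec U) = 0 ->
  0 <= lorentz (vec U) (vec U *m D) /\
  lorentz (vec U) (D *m (vec U)^T)^T <= 0.
Proof.
move=> Apsd Bpsd fA fB DT Upsd U0.
have [->|UN0] := eqVneq (vec U) 0; first by rewrite !lorentz0l.
split.
  have [i [A' [A'psd fA' A'i]]] := psd_family_through Apsd fA Upsd UN0.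
  have [A'B M3] := full_rank3_psdrank2 A'psd Bpsd fA' fB.
  have mot := DT _ _ _ _ _ M3 A'B (given_by_exists D A' B).
  have [/(_ i) + _] := motion_inward A'psd Bpsd mot.
  by rewrite /inward A'i unvecK; apply.
have [j [B' [B'psd fB' B'j]]] := psd_family_through Bpsd fB Upsd UN0.
have [AB' M3] := full_rank3_psdrank2 Apsd B'psd fA fB'.
have mot := DT _ _ _ _ _ M3 AB' (given_by_exists D A B').
have [_ /(_ j)] := motion_inward Apsd B'psd mot.
by rewrite /inward B'j unvecK lorentzNr oppr_ge0; apply.
Qed.

(** The two inequalities of [always_motion_lightlike], the second one
    transported by J, are opposite to each other. *)
Lemma always_motion_slice_eq0 p q (A : 'I_p -> 'M[R]_2) (B : 'I_q -> 'M[R]_2) e :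
  (forall i, psd (A i)) -> (forall j, psd (B j)) ->
  row_full (vecs A) -> row_full (vecs B) -> always_motion p q (slice_motion e) ->
  e = 0.
Proof.
move=> Apsd Bpsd fA fB eT; apply: quad_outer2_eq0 => s t.
have half : 0 < 2^-1 :> R by rewrite invr_gt0.
have H s' t' := always_motion_lightlike Apsd Bpsd fA fB eT (outer2_psd s' t')
  (outer2_lightlike s' t').
apply/eqP; rewrite eq_le; apply/andP; split.
  have [_] := H (- t) s.
  rewrite lorentz_motionr outer2J opprK.
  by rewrite pmulr_rle0.
by have [+ _] := H s t; rewrite lorentz_motionl pmulr_rge0.
Qed.

Lemma rigid_slice_eq0 p q (A : 'I_p -> 'M[R]_2) (B : 'I_q -> 'M[R]_2) e :
  (forall i, psd (A i)) -> (forall j, psd (B j)) ->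
  row_full (vecs A) -> row_full (vecs B) -> infinitesimally_rigid1 A B ->
  (forall i, lorentz (vec (A i)) (vec (A i)) = 0 ->
     0 <= (e *m quad_coef (vec (A i))) 0 0) ->
  (forall j, lorentz (vec (B j)) (vec (B j)) = 0 ->
     (e *m quad_coef (vec (B j) *m J)) 0 0 <= 0) ->
  e = 0.
Proof.
move=> Apsd Bpsd fA fB rigid HA HB.
have half : 0 < 2^-1 :> R by rewrite invr_gt0.
have gAB := given_by_exists (slice_motion e) A B.
have [||D gD DT] := rigid _ _ (inward_motion Apsd Bpsd gAB _ _).
- by move=> i Ai0; rewrite unvecK lorentz_motionl pmulr_rge0// HA.
- by move=> j Bj0; rewrite unvecK lorentzNr lorentz_motionr oppr_ge0 pmulr_rle0// HB.
apply: (always_motion_slice_eq0 Apsd Bpsd fA fB).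
suff <- : D = slice_motion e by move=> M A' B' dA' dB'; exact: DT.
have VD : vecs A *m D = vecs A *m slice_motion e.
  apply/row_matrixP => i; rewrite !row_mul ![row i (vecs A)]rowK.
  by have [_ <-] := gD.1 i; rewrite unvecK.
by rewrite -[D]mul1mx -(mulVpmx fA) -mulmxA VD mulmxA mulVpmx// mul1mx.
Qed.
End TrivialMotions.

(** * The GL(2)-orbit is the stabilizer of the form up to scale *)
Section Orbits.
Context {R : realType}.
Implicit Types (X Y U S : 'M[R]_2) (x y a b : 'rV[R]_3) (e : 'rV[R]_5) (G D : 'M[R]_3).

Definition mat2 (u1 u2 v1 v2 : R) : 'M[R]_2 :=
  \matrix_(i, j) if i == 0 then (if j == 0 then u1 else u2)
                 else (if j == 0 then v1 else v2).

Lemma mat2E u1 u2 v1 v2 : (mat2 u1 u2 v1 v2 0 0 = u1) * (mat2 u1 u2 v1 v2 0 1 = u2)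
  * (mat2 u1 u2 v1 v2 1 0 = v1) * (mat2 u1 u2 v1 v2 1 1 = v2).
Proof. by rewrite !mxE. Qed.

(** The congruence X |-> S^T X S in the coordinates vec.  Its rows are the
    images of E_00, E_11 and (E_01 + E_10) / sqrt 2. *)
Definition congr_mx S : 'M[R]_3 := \matrix_i
  [:: vec (outer2 (S 0 0) (S 0 1)); vec (outer2 (S 1 0) (S 1 1));
      row3 (Num.sqrt 2 * S 0 0 * S 1 0) (Num.sqrt 2 * S 0 1 * S 1 1)
           (S 0 0 * S 1 1 + S 0 1 * S 1 0)]`_i.

Lemma vec_congr S X : X^T = X -> vec (S^T *m X *m S) = vec X *m congr_mx S.
Proof.
move=> /symE X10; have r2 := @sqrt2K R.
rewrite [LHS]row3P [RHS]row3P !vecE !row3E; congr row3;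
  rewrite !mxE !sum2 !sum3 !mxE ?sum2 ?mxE /= X10; try ring.
- transitivity (X 0 0 * S 0 0 ^+ 2 + X 1 1 * S 1 0 ^+ 2
      + Num.sqrt 2 ^+ 2 * X 0 1 * (S 0 0 * S 1 0));
    last by ring.
  by rewrite r2; ring.
- transitivity (X 0 0 * S 0 1 ^+ 2 + X 1 1 * S 1 1 ^+ 2
      + Num.sqrt 2 ^+ 2 * X 0 1 * (S 0 1 * S 1 1));
    last by ring.
  by rewrite r2; ring.
Qed.

Lemma vec_congrT S X : X^T = X -> vec (S *m X *m S^T) = vec X *m (congr_mx S)^T.
Proof.
move=> /symE X10; have r2 := @sqrt2K R.
rewrite [LHS]row3P [RHS]row3P !vecE !row3E; congr row3;
  rewrite !mxE !sum2 !sum3 !mxE ?sum2 ?mxE /= X10.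
- transitivity (X 0 0 * S 0 0 ^+ 2 + X 1 1 * S 0 1 ^+ 2
      + Num.sqrt 2 ^+ 2 * X 0 1 * (S 0 0 * S 0 1));
    last by ring.
  by rewrite r2; ring.
- transitivity (X 0 0 * S 1 0 ^+ 2 + X 1 1 * S 1 1 ^+ 2
      + Num.sqrt 2 ^+ 2 * X 0 1 * (S 1 0 * S 1 1));
    last by ring.
  by rewrite r2; ring.
- ring.
Qed.

(** The pullback of the Lorentz form by x |-> x G. *)
Definition gram G : 'M[R]_3 := G *m J *m G^T.

Lemma gram_rowE G i j : gram G i j = lorentz (row i G) (row j G).
Proof.
rewrite /gram lorentzE -row_mul [LHS]mxE [RHS]mxE; apply: eq_bigr => k _.
by rewrite !mxE.
Qed.

Lemma congr_mx_gram S : gram (congr_mx S) = \det S ^+ 2 *: J.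
Proof.
have r2 := @sqrt2K R.
apply/matrixP => i j; rewrite gram_rowE !rowK det2; move: i j.
apply: all_I3; apply: all_I3; rewrite [RHS]mxE [J _ _]mxE /= ?lorentz_vecE
  /lorentz ?vecE ?row3E ?sym2E; try ring.
transitivity (Num.sqrt 2 ^+ 2 * (2 * S 0 0 * S 1 0 * (S 0 1 * S 1 1)) -
  (S 0 0 * S 1 1 + S 0 1 * S 1 0) ^+ 2); first by ring.
by rewrite r2; ring.
Qed.

Lemma gram_inv c G : c != 0 -> gram G = c *: J ->
  J *m G^T *m (c^-1 *: (J *m G)) = 1%:M.
Proof.
rewrite /gram => c0 E; have GK : G *m (c^-1 *: (J *m G^T *m J)) = 1%:M.
  by rewrite -scalemxAr !mulmxA E -scalemxAl JJ scalerA mulVf// scale1r.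
by rewrite -(mulmx1C GK) -scalemxAl -scalemxAr !mulmxA.
Qed.

(** A vector on the boundary of the positive light cone is a rank one psd
    matrix u u^T; the square root of its first coordinate gives u. *)
Lemma lightlike_outer2 x : 0 < x 0 0 -> lorentz x x = 0 ->
  exists u1 u2, x = vec (outer2 u1 u2).
Proof.
move=> x0; rewrite /lorentz => /eqP; rewrite subr_eq0 => /eqP E.
have u0 : Num.sqrt (x 0 0) != 0 by rewrite sqrtr_eq0 -ltNge.
have uu : Num.sqrt (x 0 0) ^+ 2 = x 0 0 by rewrite sqr_sqrtr ?ltW.
have r0 := @sqrt2_neq0 R; have r2 := @sqrt2K R.
exists (Num.sqrt (x 0 0)), (x 0 ord_max / (Num.sqrt 2 * Num.sqrt (x 0 0))).
rewrite [LHS]row3P vecE !sym2E uu; congr row3.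
  rewrite expr_div_n exprMn uu r2 expr2 -E.
  by field; rewrite gt_eqF.
by field; rewrite u0.
Qed.

Lemma lightlike_outer2_snd x : 0 < x 0 1 -> lorentz x x = 0 ->
  exists u1 u2, x = vec (outer2 u1 u2).
Proof.
move=> x1 E.
have [||u1 [u2 xE]] := @lightlike_outer2 (row3 (x 0 1) (x 0 0) (x 0 ord_max)).
- by rewrite row3E.
- by rewrite -E /lorentz !row3E; ring.
- exists u2, u1; rewrite [LHS]row3P vecE !sym2E.
  have /rowP H := xE; have := (H 0, H 1, H ord_max).
  rewrite vecE !row3E !sym2E => -[[-> ->] ->]; congr row3; ring.
Qed.

(** The first two rows of G are lightlike and positive, so they are u u^T and
    v v^T; this determines S with rows u and v up to the signs of u and v.
    The third row is orthogonal to the first two for the Lorentz form, as is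
    the third row w of [congr_mx S]; that orthogonal is a line, so the third
    row is k w, and k = 1 or k = -1 by comparing norms.  Replacing v by - v
    changes the sign of w and nothing else. *)
Lemma gram_congr_mx c G : 0 < c -> 0 < G 0 0 -> 0 < G 1 1 ->
  gram G = c *: J -> exists2 S, S \in unitmx & G = congr_mx S.
Proof.
move=> c0 G00 G11 E; have cN0 : c != 0 by rewrite gt_eqF.
have gramG i j : lorentz (row i G) (row j G) = c * J i j.
  by rewrite -gram_rowE E mxE.
have [||u1 [u2 Eu]] := @lightlike_outer2 (row 0 G).
- by rewrite mxE.
- by rewrite gramG mxE /= mulr0.
have [||v1 [v2 Ev]] := @lightlike_outer2_snd (row 1 G).
- by rewrite mxE.
- by rewrite gramG mxE /= mulr0.
pose S := mat2 u1 u2 v1 v2; pose w := row ord_max (congr_mx S).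
have row0 : row 0 (congr_mx S) = row 0 G by rewrite Eu rowK !mat2E.
have row1 : row 1 (congr_mx S) = row 1 G by rewrite Ev rowK !mat2E.
have dS : \det S ^+ 2 = c.
  have := gram_rowE (congr_mx S) 0 1; rewrite congr_mx_gram row0 row1 gramG.
  by rewrite !mxE /= !mulr1.
have SE : gram (congr_mx S) = c *: J by rewrite congr_mx_gram dS.
have gramS i j : lorentz (row i (congr_mx S)) (row j (congr_mx S)) = c * J i j.
  by rewrite -gram_rowE SE mxE.
have Su : S \in unitmx.
  by rewrite unitmxE unitfE -sqrf_eq0 dS.
pose k := - c^-1 * lorentz (row ord_max G) w.
have lorentzBZ x y z l : lorentz (x - l *: y) z = lorentz x z - l * lorentz y z.
  by rewrite /lorentz !mxE; ring.
have t0 : row ord_max G - k *: w = 0.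
  rewrite -[LHS]mulmx1 -(gram_inv cN0 SE) !mulmxA.
  suff -> : (row ord_max G - k *: w) *m J *m (congr_mx S)^T = 0 by rewrite mul0mx.
  apply/rowP => j; rewrite [RHS]mxE.
  have -> : ((row ord_max G - k *: w) *m J *m (congr_mx S)^T) 0 j =
     lorentz (row ord_max G - k *: w) (row j (congr_mx S)).
    rewrite lorentzE [LHS]mxE [RHS]mxE; apply: eq_bigr => l _.
    by congr (_ * _); rewrite !mxE.
  rewrite lorentzBZ; move: j; apply: all_I3.
  - by rewrite gramS row0 gramG !mxE /=; ring.
  - by rewrite gramS row1 gramG !mxE /=; ring.
  - by rewrite -/w gramS /k !mxE /=; field.
have row2 : row ord_max G = k *: w by apply/eqP; rewrite -subr_eq0 t0.
have : k ^+ 2 = 1.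
  have := gramG ord_max ord_max; rewrite row2.
  have -> : lorentz (k *: w) (k *: w) = k ^+ 2 * lorentz w w.
    by rewrite /lorentz !mxE; ring.
  rewrite gramS [J _ _]mxE /= => H.
  by apply: (mulIf cN0); lra.
move/eqP; rewrite sqrf_eq1 => /orP[/eqP k1|/eqP k1].
  exists S => //; apply/row_matrixP; apply: all_I3 => //.
  by rewrite row2 k1 scale1r.
exists (mat2 u1 u2 (- v1) (- v2)).
  rewrite unitmxE unitfE; move: Su; rewrite unitmxE unitfE !det2 !mat2E.
  by apply: contraNN => /eqP H; apply/eqP; lra.
apply/row_matrixP; apply: all_I3.
- by rewrite Eu rowK !mat2E.
- by rewrite Ev rowK !mat2E /= /outer2 !sqrrN mulrNN.
- rewrite row2 k1 scaleN1r !rowK !mat2E /=.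
  rewrite [LHS]row3P; congr row3; rewrite !mxE /= ; ring.
Qed.

(** The B side follows from the A side because the adjoint of X |-> S^T X S
    for the trace form is Y |-> S Y S^T. *)
Lemma psd_congr_orbit p q (A A' : 'I_p -> 'M[R]_2) (B B' : 'I_q -> 'M[R]_2) S :
  (forall i, psd (A i)) -> (forall j, psd (B j)) ->
  (forall i, psd (A' i)) -> (forall j, psd (B' j)) -> S \in unitmx ->
  vecs A' = vecs A *m congr_mx S -> (vecs B)^T = congr_mx S *m (vecs B')^T ->
  same_GL2_orbit A B A' B'.
Proof.
have congr_sym (T X : 'M[R]_2) : X^T = X -> (T *m X *m T^T)^T = T *m X *m T^T.
  by move=> XT; rewrite !trmx_mul XT trmxK mulmxA.
move=> Ap Bp A'p B'p Su EA EB; exists S => //; split=> i.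
  apply: vec_inj; first exact: (A'p i).1.
    by rewrite -{2}[S]trmxK congr_sym ?trmxK//; exact: (Ap i).1.
  rewrite vec_congr; last exact: (Ap i).1.
  have := congr1 (row i) EA; rewrite row_mul [row i (vecs A')]rowK.
  by rewrite [row i (vecs A)]rowK.
have -> : B i = S *m B' i *m S^T.
  apply: vec_inj; [exact: (Bp i).1|by rewrite congr_sym//; exact: (B'p i).1|].
  rewrite vec_congrT; last exact: (B'p i).1.
  have := congr1 (row i) (congr1 trmx EB); rewrite trmxK trmx_mul trmxK row_mul.
  by rewrite [row i (vecs B')]rowK [row i (vecs B)]rowK.
rewrite !mulmxA mulVmx// mul1mx -mulmxA trmx_inv mulmxV ?mulmx1//.
by rewrite unitmx_tr.
Qed.

End Orbits.

(** * The constraints of the dual side to second order *)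
Section SecondOrder.
Context {R : realType}.
Implicit Types (X Y U S : 'M[R]_2) (x y a b : 'rV[R]_3) (e : 'rV[R]_5) (G D : 'M[R]_3).

(** Up to a positive factor the adjugate of N = k G J G^T is its inverse, whose
    quadratic form at b = b' G^T is q(b') / k.  The adjugate is preferred to the inverse
    because it is polynomial in N. *)
Lemma adj_quad_ge0 k G b b' : 0 < k -> G \in unitmx ->
  b^T = G *m b'^T -> 0 <= lorentz b' b' ->
  0 <= (b *m \adj (k *: gram G) *m b^T) 0 0.
Proof.
move=> k0 Gu bE b'0; set N := k *: _.
have kN0 : k != 0 by rewrite gt_eqF.
have dN : \det N = k * (k ^+ 2 * \det G ^+ 2).
  by rewrite detZ /gram !det_mulmx det_J det_tr; ring.
have K : G^T *m \adj N *m G = (k ^+ 2 * \det G ^+ 2) *: J.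
  have KJ : G^T *m \adj N *m G *m J = (k ^+ 2 * \det G ^+ 2)%:M.
    have GTu : G^T \in unitmx by rewrite unitmx_tr.
    apply: (can_inj (mulmxK GTu)).
    have -> : G^T *m \adj N *m G *m J *m G^T = G^T *m (\adj N *m (k^-1 *: N)).
      by rewrite /N scalerA mulVf// scale1r /gram !mulmxA.
    rewrite -scalemxAr mul_adj_mx dN scale_scalar_mx mul_mx_scalar mul_scalar_mx.
    by rewrite mulKf.
  by rewrite -[LHS]mulmx1 -JJ mulmxA KJ mul_scalar_mx.
have bE' : b = b' *m G^T by rewrite -[b]trmxK bE trmx_mul trmxK.
have -> : b *m \adj N *m b^T = b' *m (G^T *m \adj N *m G) *m b'^T.
  by rewrite bE bE' !mulmxA.
rewrite K -scalemxAr -scalemxAl mxE -lorentzE.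
by rewrite mulr_ge0// mulr_ge0 ?sqr_ge0.
Qed.

(** On the light cone the constant term of adj (J + E), which is J, drops out,
    and so does the part tr (J E) J of its linear term; what remains of
    the linear term is - J E J, and the quadratic term is adj E. *)
Lemma adj_quad_expand e b : lorentz b b = 0 ->
  (b *m \adj (J + slice_mx e) *m b^T) 0 0 =
  - (e *m quad_coef (b *m J)) 0 0 + (b *m \adj (slice_mx e) *m b^T) 0 0.
Proof.
move=> b0.
transitivity (lorentz b b * (1 - e 0 (@Ordinal 5 2 isT))
   - (e *m quad_coef (b *m J)) 0 0 + (b *m \adj (slice_mx e) *m b^T) 0 0); last first.
  by rewrite b0 mul0r add0r.
rewrite mulJE /lorentz !mxE !sum5 !sum3 !mxE !sum3 !mxE /cofactor !det2 !mxE /=.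
by ring.
Qed.

Lemma adj_quad_bound b : exists C, forall e,
  `|(b *m \adj (slice_mx e) *m b^T) 0 0| <= C * `|e| ^+ 2.
Proof.
exists (\sum_j \sum_i `|b 0 i| * 2 * `|b 0 j|) => e.
have E i j : `|e 0 i * e 0 j| <= `|e| ^+ 2.
  by rewrite normrM expr2 ler_pM// entry_le_norm.
have adjE i j : `|\adj (slice_mx e) i j| <= 2 * `|e| ^+ 2.
  have H (z w : R) : `|z| <= `|e| ^+ 2 -> `|w| <= `|e| ^+ 2 ->
      `|z - w| <= 2 * `|e| ^+ 2.
    by move=> hz hw; apply: le_trans (ler_normB _ _) _; lra.
  have e0 : `|0 : R| <= `|e| ^+ 2 by rewrite normr0 sqr_ge0.
  rewrite mxE /cofactor normrM normrX normrN1 expr1n mul1r det2.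
  move: i j; apply: all_I3; apply: all_I3; rewrite !mxE /= ?(mulr0, mul0r);
   exact: H.
set K := \adj _ in adjE *.
rewrite mxE (le_trans (ler_norm_sum _ _ _))// mulr_suml; apply: ler_sum => j _.
rewrite normrM [(_ *m K) _ _]mxE [b^T _ _]mxE.
apply: (@le_trans _ _ ((\sum_i `|b 0 i * K i j|) * `|b 0 j|)).
  by rewrite ler_wpM2r// ler_norm_sum.
rewrite !mulr_suml; apply: ler_sum => i _.
rewrite normrM [leRHS]mulrAC.
by rewrite ler_wpM2r// -mulrA ler_wpM2l.
Qed.

End SecondOrder.

(** * Factorizations near the given one *)
Section NearIdentity.
Context {R : realType}.
Implicit Types (X Y U S : 'M[R]_2) (x y a b : 'rV[R]_3) (e : 'rV[R]_5) (G D : 'M[R]_3).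

(** Both stacked matrices have the same column space, namely that of M, which
    gives some X with vecs A' = vecs A X; the left inverse of vecs A identifies
    X with G. *)
Lemma factorization_transition p q (M : 'M[R]_(p, q)) A B A' B' :
  \rank M = 3%N -> psd_factorization M A B -> psd_factorization M A' B' ->
  let G := pinvmx (vecs A) *m vecs A' in
  vecs A' = vecs A *m G /\ (vecs B)^T = G *m (vecs B')^T.
Proof.
move=> M3 MAB MAB' G; have [fA fB] := rank3_vecs M3 MAB.
have [fA' fB'] := rank3_vecs M3 MAB'.
have E := factorization_vecs MAB; have E' := factorization_vecs MAB'.
have BB : (vecs B')^T *m (pinvmx (vecs B'))^T = 1%:M.
  by rewrite -trmx_mul mulVpmx// trmx1.
have A'E : vecs A' = vecs A *m ((vecs B)^T *m (pinvmx (vecs B'))^T).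
  by rewrite mulmxA -E E' -mulmxA BB mulmx1.
have GE : G = (vecs B)^T *m (pinvmx (vecs B'))^T.
  by rewrite /G A'E [LHS]mulmxA mulVpmx// mul1mx.
split; first by rewrite GE.
by rewrite /G -mulmxA -E' E [RHS]mulmxA mulVpmx// mul1mx.
Qed.

(** The coordinates of E in gram G / c = J + E, where c = gram G 0 1; the
    third one has + 1 because J has - 1 at that place. *)
Definition deviation G : 'rV[R]_5 := let c := gram G 0 1 in
  \row_j [:: gram G 0 0 / c; gram G 1 1 / c; gram G ord_max ord_max / c + 1;
             gram G 0 ord_max / c; gram G 1 ord_max / c]`_j.

Lemma gram_sym G i j : gram G i j = gram G j i.
Proof.
have E : (gram G)^T = gram G by rewrite /gram !trmx_mul J_tr trmxK mulmxA.
by rewrite -{1}E mxE.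
Qed.

Lemma deviationE G : gram G 0 1 != 0 ->
  (gram G 0 1)^-1 *: gram G = J + slice_mx (deviation G).
Proof.
move=> c0; apply/matrixP; apply: all_I3; apply: all_I3;
rewrite [LHS]mxE [RHS]mxE [J _ _]mxE [slice_mx _ _ _]mxE /= ?[deviation _ _ _]mxE /=;
rewrite ?(gram_sym G 1 0) ?(gram_sym G ord_max 0) ?(gram_sym G ord_max 1); by field.
Qed.

(** The rank one factors A(i) and B(j) index the inequalities satisfied by the
    deviation of G: those of the A(i) are linear, those of the B(j) have the
    remainder of [adj_quad_expand].  Infinitesimal rigidity is what makes 0
    the only solution of their linear part. *)
Lemma rigid_near_identity p q (M : 'M[R]_(p, q)) A B :
  \rank M = 3%N -> psd_factorization M A B -> infinitesimally_rigid1 A B ->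
  exists2 eps, 0 < eps & forall A' B', psd_factorization M A' B' ->
    let G := pinvmx (vecs A) *m vecs A' in
    0 < G 0 0 -> 0 < G 1 1 -> 0 < gram G 0 1 ->
    (forall j, `|deviation G 0 j| < eps) -> same_GL2_orbit A B A' B'.
Proof.
move=> M3 MAB rigid; have [Apsd Bpsd _] := MAB.
have [fA fB] := rank3_vecs M3 MAB.
pose T : finType := ('I_p + 'I_q)%type.
pose row_of (k : T) := match k with inl i => vec (A i) | inr j => vec (B j) end.
pose P (k : T) := lorentz (row_of k) (row_of k) == 0.
pose l (k : T) := match k with
  | inl i => quad_coef (vec (A i)) | inr j => - quad_coef (vec (B j) *m J) end.
pose r (k : T) e := match k with
  | inl i => 0 | inr j => (vec (B j) *m \adj (slice_mx e) *m (vec (B j))^T) 0 0 end.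
have /choice[C rC] : forall k, exists C, forall e, `|r k e| <= C * `|e| ^+ 2.
  case=> [i|j]; last exact: adj_quad_bound.
  by exists 0 => e; rewrite normr0 mul0r.
have l0 e : (forall k, P k -> 0 <= (e *m l k) 0 0) -> e = 0.
  move=> H; apply: (rigid_slice_eq0 Apsd Bpsd fA fB rigid).
    by move=> i /eqP; exact: (H (inl i)).
  move=> j /eqP /(H (inr j)); rewrite /l mulmxN.
  by rewrite [in X in X -> _]mxE oppr_ge0.
have [eps eps0 iso] := isolated_zero l0 rC.
exists eps => // A' B' MAB' G G00 G11 c0 dev.
have [A'psd B'psd _] := MAB'.
have [EA EB] := factorization_transition M3 MAB MAB'.
rewrite -/G in EA EB; clearbody G.
have Gu : G \in unitmx.
  rewrite -row_full_unit.
  have fBT : \rank (vecs B)^T = 3%N by rewrite mxrank_tr; exact/eqP.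
  by rewrite /row_full eqn_leq rank_leq_col -{1}fBT EB mxrankM_maxl.
set c := gram G 0 1 in c0; have cN0 : c != 0 by rewrite gt_eqF.
have cV0 : 0 < c^-1 by rewrite invr_gt0.
have d0 : deviation G = 0.
  apply: iso => // -[i|j] /eqP /= q0.
    rewrite addr0 quad_coefE.
    have -> : slice_mx (deviation G) = c^-1 *: gram G - J.
      by rewrite deviationE// addrC addKr.
    have entryB (X Y : 'M[R]_1) : (X - Y) 0 0 = X 0 0 - Y 0 0 by rewrite !mxE.
    rewrite mulmxBr mulmxBl entryB -lorentzE q0 subr0.
    rewrite -scalemxAr -scalemxAl mxE pmulr_rge0//.
    have -> : vec (A i) *m gram G *m (vec (A i))^T =
        vec (A' i) *m J *m (vec (A' i))^T.
      have -> : vec (A' i) = vec (A i) *m G.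
        have := congr1 (row i) EA; rewrite row_mul [row i (vecs A')]rowK.
        by rewrite [row i (vecs A)]rowK.
      by rewrite /gram trmx_mul !mulmxA.
    by rewrite -lorentzE; have /psd_lorentz[] := A'psd i.
  have := adj_quad_ge0 (k := c^-1) (G := G) (b := vec (B j)) (b' := vec (B' j)) cV0 Gu.
  rewrite deviationE// adj_quad_expand// mulmxN.
  have entryN (X : 'M[R]_1) : (- X) 0 0 = - X 0 0 by rewrite mxE.
  rewrite entryN; apply; last by have /psd_lorentz[] := B'psd j.
  have := congr1 (row j) (congr1 trmx EB); rewrite trmxK trmx_mul trmxK row_mul.
  rewrite [row j (vecs B)]rowK [row j (vecs B')]rowK => ->.
  by rewrite trmx_mul trmxK.
have NJ : gram G = c *: J.
  have := deviationE cN0; rewrite d0 -/c.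
  have -> : slice_mx (0 : 'rV[R]_5) = 0.
    by apply/matrixP; apply: all_I3; apply: all_I3; rewrite !mxE /= ?mxE.
  by rewrite addr0 => <-; rewrite scalerA mulfV// scale1r.
have [S Su GS] := gram_congr_mx c0 G00 G11 NJ.
by apply: (psd_congr_orbit Apsd Bpsd A'psd B'psd Su); rewrite -GS.
Qed.
End NearIdentity.

(** * Passage to the topology of factorizations *)
Section Topology.
Context {R : realType}.
Local Open Scope classical_set_scope.

Lemma cvg_factor_entry p q (A : 'I_p -> 'M[R]_2) (B : 'I_q -> 'M[R]_2) i a b :
  (F.1 : 'I_p -> 'M[R]_2) i a b
    @[F --> ((A, B) : {ptws 'I_p -> 'M[R]_2} * {ptws 'I_q -> 'M[R]_2})]
  --> A i a b.
Proof.
have h1 : F.1 @[F --> ((A, B) : {ptws 'I_p -> 'M[R]_2} * {ptws 'I_q -> 'M[R]_2})]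
    --> (A : {ptws 'I_p -> 'M[R]_2}) by exact: cvg_fst.
have h2 := cvg_comp _ _ h1 (@proj_continuous _ _ i A).
exact: (cvg_comp _ _ h2 (@coord_continuous R 2 2 a b (A i))).
Qed.

Lemma cvg_vec_entry (T : Type) (F : set_system T) (FF : Filter F)
    (f : T -> 'M[R]_2) (X : 'M[R]_2) k :
  (forall a b, f t a b @[t --> F] --> X a b) ->
  vec (f t) 0 k @[t --> F] --> vec X 0 k.
Proof.
move=> fX; move: k; apply: all_I3; rewrite vecE row3E.
- by under eq_cvg do rewrite vecE row3E; exact: fX.
- by under eq_cvg do rewrite vecE row3E; exact: fX.
- under eq_cvg do rewrite vecE row3E.
  by apply: cvgM; [exact: cvg_cst|exact: fX].
Qed.

Lemma gramE (G : 'M[R]_3) i j :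
  gram G i j = G i 0 * G j 1 + G i 1 * G j 0 - G i ord_max * G j ord_max.
Proof. by rewrite /gram gram_rowE /lorentz !mxE. Qed.

Section Convergence.
Variables (T : Type) (F : set_system T) (FF : Filter F) (G : T -> 'M[R]_3).
Hypothesis G1 : forall k l, G t k l @[t --> F] --> (1%:M : 'M[R]_3) k l.

Lemma cvg_gram i j : gram (G t) i j @[t --> F] --> (J : 'M[R]_3) i j.
Proof.
under eq_cvg do rewrite gramE.
have -> : (J : 'M[R]_3) i j = gram 1%:M i j by rewrite /gram mul1mx trmx1 mulmx1.
rewrite gramE.
by apply: cvgB; [apply: cvgD|]; apply: cvgM; exact: G1.
Qed.

Lemma cvg_deviation j : deviation (G t) 0 j @[t --> F] --> (0 : R).
Proof.
have c1 : (gram (G t) 0 1)^-1 @[t --> F] --> (1 : R).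
  have := @cvg_gram 0 1; rewrite mxE /= => c1.
  by have := cvgV (oner_neq0 R) c1; rewrite invr1; exact.
have cd i k (a : R) : (J : 'M[R]_3) i k = a ->
    gram (G t) i k / gram (G t) 0 1 @[t --> F] --> a.
  by move=> <-; rewrite -[(J : 'M[R]_3) i k]mulr1; apply: cvgM => //;
    exact: (@cvg_gram i k).
have cd2 : gram (G t) ord_max ord_max / gram (G t) 0 1 + 1 @[t --> F] --> (0 : R).
  have h : gram (G t) ord_max ord_max / gram (G t) 0 1 @[t --> F] --> (-1 : R).
    by apply: cd; rewrite mxE.
  by have := cvgD h (cvg_cst (1 : R)); rewrite addNr; exact.
under eq_cvg do rewrite mxE.
by case: j => [[|[|[|[|[|//]]]]] hj] //=; apply: cd; rewrite ?mxE.
Qed.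

End Convergence.

End Topology.

Theorem theorem7 (R : realType) (p q : nat) (M : 'M[R]_(p, q))
    (A : 'I_p -> 'M[R]_2) (B : 'I_q -> 'M[R]_2) :
  rank3_psdrank2 M -> psd_factorization M A B ->
  infinitesimally_rigid1 A B -> locally_rigid M A B.
Proof.
move=> [_ M3 _] MAB rigid.
have [eps eps0 near_id] := rigid_near_identity M3 MAB rigid.
have [fA _] := rank3_vecs M3 MAB.
pose G (F : {ptws 'I_p -> 'M[R]_2} * {ptws 'I_q -> 'M[R]_2}) :=
  pinvmx (vecs A) *m vecs F.1.
have G1 k l : (G F k l
    @[F --> ((A, B) : {ptws 'I_p -> 'M[R]_2} * {ptws 'I_q -> 'M[R]_2})]
    --> (1%:M : 'M[R]_3) k l)%classic.
  rewrite -(mulVpmx fA) mxE; under eq_cvg do rewrite mxE.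
  apply: cvg_sumr => i _; apply: cvgM; first exact: cvg_cst.
  under eq_cvg do rewrite mxE; rewrite mxE.
  by apply: cvg_vec_entry => a b; exact: cvg_factor_entry.
rewrite /locally_rigid near_withinE; near=> F => FM.
apply: near_id => //; rewrite -/(G F).
- near: F; apply: (cvgr_gt _ (G1 0 0)); by rewrite mxE.
- near: F; apply: (cvgr_gt _ (G1 1 1)); by rewrite mxE.
- near: F; apply: (cvgr_gt _ (@cvg_gram _ _ _ _ _ G1 0 1)); by rewrite mxE.
- near: F; apply: filter_forall => j.
  have /cvgrPdist_lt : (deviation (G F) 0 j @[F -->
      ((A, B) : {ptws 'I_p -> 'M[R]_2} * {ptws 'I_q -> 'M[R]_2})] --> (0 : R))%classic.
    exact: cvg_deviation.
  move=> /(_ _ eps0).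
  by apply: filterS => F; rewrite sub0r normrN.
Unshelve. all: by end_near.
Qed.
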